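(* Let $V$ be a norm-closed linear subspace of $\mathbf{C}(\mathfrak{X})$. Then $\mathcal{R}_V$ is a cc-closed right ideal of $\mathcal{M}$, and $\mathcal{L}_V$ is an rc-closed left ideal of $\mathcal{M}$. Moreover, if $V$ is pc-closed, then $\mathcal{R}_V$ and $\mathcal{L}_V$ are pc-closed.
   Context: $\mathfrak{X}$ is a fixed compact metrizable space and $\mathfrak{m}$ is a fixed Borel probability measure on $\mathfrak{X}$ whose support is all of $\mathfrak{X}$. $\mathbf{C}(\mathfrak{X})$ is the Banach space of continuous complex functions on $\mathfrak{X}$ with the supremum norm. $\mathcal{M}=\mathcal{M}_{\mathfrak{X},\mathfrak{m}}$ denotes the Banach $*$-algebra $\mathbf{C}(\mathfrak{X}^2)$ of continuous complex functions on $\mathfrak{X}\times\mathfrak{X}$ with the supremum norm, the multiplication $(f\star g)(x,y)=\int_{\mathfrak{X}}f(x,z)g(z,y)\,d\mathfrak{m}(z)$ and the involution $f^*(x,y)=\overline{f(y,x)}$. For a norm-closed linear subspace $V$ of $\mathbf{C}(\mathfrak{X})$ put $\mathcal{R}_V:=\{f\in\mathcal{M}: f(\cdot,y)\in V\text{ for every }y\in\mathfrak{X}\}$ and $\mathcal{L}_V:=\{f\in\mathcal{M}: f(x,\cdot)\in V\text{ for every }x\in\mathfrak{X}\}$. The pointwise convergence topology (pct) on $\mathbf{C}(\mathfrak{X})$ and on $\mathcal{M}=\mathbf{C}(\mathfrak{X}^2)$ is the topology of pointwise convergence of functions. The column-wise convergence topology (cct) on $\mathcal{M}$ is the vector topology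 in which $f_\lambda\to f$ iff $\sup_{x}|f_\lambda(x,y)-f(x,y)|\to0$ for every $y\in\mathfrak{X}$; the row-wise convergence topology (rct) is the vector topology in which $f_\lambda\to f$ iff $\sup_{y}|f_\lambda(x,y)-f(x,y)|\to0$ for every $x\in\mathfrak{X}$. The terms pc-closed, cc-closed, rc-closed mean closed in the pct, cct, rct respectively. *)

(* Defs.v *)
From HB Require Import structures.
From mathcomp Require Import all_boot all_order all_algebra.
From mathcomp Require Import all_classical all_reals all_analysis.
From mathcomp Require Import complex.

Set Implicit Arguments.
Unset Strict Implicit.
Unset Printing Implicit Defensive.

Import Order.TTheory GRing.Theory Num.Theory.
Import numFieldTopology.Exports numFieldNormedType.Exports.

Local Open Scope classical_set_scope.
Local Open Scope ring_scope.

Definition metrizable (R : realType) (T : topologicalType) : Prop :=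
  exists d : T -> T -> R,
    [/\ forall x y, (d x y = 0) <-> (x = y),
        forall x y, d x y = d y x,
        forall x y z, d x z <= d x y + d y z &
        forall (x : T) (A : set T),
          nbhs x A <-> exists2 e : R, 0 < e & [set y | d x y < e] `<=` A].

(* Measurable spaces are pointed in the library, hence [ptopologicalType]; a
   space carrying a probability measure is nonempty anyway. *)
Notation borelType X := (g_sigma_algebraType (@open X)).

Definition msupport (R : realType) (X : ptopologicalType)
    (m : probability (borelType X) R) : set X :=
  [set x | forall U : set X, open U -> U x -> (0 < m U)%E].

(* [R[i]^o] is the field of complex numbers with its usual topology. *)
Notation cfun R T := (continuousType T (R[i])^o).

Section FunctionSpace.
Context {R : realType} {T : topologicalType}.
Implicit Types f g h : cfun R T.

Lemma cfun0_cts : continuous (fun _ : T => 0 : R[i]^o).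
Proof. exact: cst_continuous. Qed.

Lemma cfunN_cts f : continuous (fun x => - f x).
Proof. by move=> x; apply: cvgN; exact: cts_fun. Qed.

Lemma cfunD_cts f g : continuous (fun x => f x + g x).
Proof. by move=> x; apply: cvgD; exact: cts_fun. Qed.

Lemma cfunZ_cts (a : R[i]) f : continuous (fun x => a *: f x).
Proof. by move=> x; apply: cvgZl_tmp; exact: cts_fun. Qed.

Definition cfun0 : cfun R T := mkcts cfun0_cts.
Definition cfunN f : cfun R T := mkcts (@cfunN_cts f).
Definition cfunD f g : cfun R T := mkcts (@cfunD_cts f g).
Definition cfunZ (a : R[i]) f : cfun R T := mkcts (@cfunZ_cts a f).

Fact cfun_addA : associative cfunD.
Proof. by move=> f g h; apply/continuousEP => x; exact: addrA. Qed.
Fact cfun_addC : commutative cfunD.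
Proof. by move=> f g; apply/continuousEP => x; exact: addrC. Qed.
Fact cfun_add0 : left_id cfun0 cfunD.
Proof. by move=> f; apply/continuousEP => x; exact: add0r. Qed.
Fact cfun_addN : left_inverse cfun0 cfunN cfunD.
Proof. by move=> f; apply/continuousEP => x; exact: addNr. Qed.

HB.instance Definition _ := GRing.isZmodule.Build (cfun R T)
  cfun_addA cfun_addC cfun_add0 cfun_addN.

Fact cfun_scaleA (a b : R[i]) f : cfunZ a (cfunZ b f) = cfunZ (a * b) f.
Proof. by apply/continuousEP => x; exact: scalerA. Qed.
Fact cfun_scale1 : left_id 1 cfunZ.
Proof. by move=> f; apply/continuousEP => x; exact: scale1r. Qed.
Fact cfun_scaleDr : right_distributive cfunZ +%R.
Proof. by move=> a f g; apply/continuousEP => x; exact: scalerDr. Qed.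
Fact cfun_scaleDl f : {morph cfunZ^~ f : a b / a + b}.
Proof. by move=> a b; apply/continuousEP => x; exact: scalerDl. Qed.

HB.instance Definition _ := GRing.Zmodule_isLmodule.Build R[i] (cfun R T)
  cfun_scaleA cfun_scale1 cfun_scaleDr cfun_scaleDl.

(* The topology of the supremum norm is that of uniform convergence; see
   [norm_top_cvgP] below. *)
Definition norm_top : topologicalType :=
  initial_topology (fun f : cfun R T => (f : {uniform T -> (R[i])^o})).
Definition pct : topologicalType :=
  initial_topology (fun f : cfun R T => (f : {ptws T -> (R[i])^o})).

Definition norm_closed (A : set (cfun R T)) := closed (A : set norm_top).
Definition pc_closed (A : set (cfun R T)) := closed (A : set pct).

End FunctionSpace.

Section ComplexIntegral.
Context {R : realType}.

Lemma Re_cts : continuous (fun z : R[i]^o => complex.Re z : R).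
Proof.
move=> z; apply/(@cvgrPdist_lt _ _ _ _ (@nbhs_filter (R[i]^o) z)) => e e0.
have e0' : 0 < e%:C%C :> R[i] by rewrite ltcR.
apply: filterS (nbhsx_ballx (z : R[i]^o) _ e0') => w; rewrite -ball_normE /ball_/= => zw.
rewrite -raddfB -ltcR; exact: le_lt_trans (normc_ge_Re _) zw.
Qed.

Lemma Im_cts : continuous (fun z : R[i]^o => complex.Im z : R).
Proof.
move=> z; apply/(@cvgrPdist_lt _ _ _ _ (@nbhs_filter (R[i]^o) z)) => e e0.
have e0' : 0 < e%:C%C :> R[i] by rewrite ltcR.
apply: filterS (nbhsx_ballx (z : R[i]^o) _ e0') => w; rewrite -ball_normE /ball_/= => zw.
rewrite -raddfB -ltcR; apply: le_lt_trans zw.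
rewrite normc_def lecR -sqrtr_sqr ler_wsqrtr//=.
by rewrite lerDr sqr_ge0.
Qed.

Lemma Complex_cts (T : topologicalType) (u v : T -> R) :
  continuous u -> continuous v ->
  continuous (fun t => Complex (u t) (v t) : R[i]^o).
Proof.
move=> uc vc t; apply/cvgrPdist_lt => e e0.
have eE : e = (complex.Re e)%:C%C by rewrite RRe_real// gtr0_real.
have e0' : 0 < complex.Re e by rewrite -ltcR -eE.
near=> s.
rewrite eE.
have -> : (Complex (u t) (v t) : R[i]^o) - Complex (u s) (v s) =
   (u t - u s)%:C%C + 'i%C * (v t - v s)%:C%C :> R[i].
  by simpc.
apply: (le_lt_trans (ler_normD _ _)).
rewrite normrM.
have -> : `|'i%C : R[i]| = 1 by rewrite normc_def/= expr0n/= expr1n add0r sqrtr1.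
rewrite mul1r !normc_def/= !expr0n/= !addr0 !sqrtr_sqr -rmorphD ltcR.
rewrite (splitr (complex.Re e)); apply: ltrD.
- by near: s; apply: (@cvgr_dist_lt _ _ _ (nbhs t) _); [exact: uc|rewrite divr_gt0].
- by near: s; apply: (@cvgr_dist_lt _ _ _ (nbhs t) _); [exact: vc|rewrite divr_gt0].
Unshelve. all: by end_near. Qed.

Context {X : ptopologicalType}.
Variable m : probability (borelType X) R.

Definition cintegral (h : X -> R[i]) : R[i] :=
  Complex (\int[m]_(z in setT) complex.Re (h z))
          (\int[m]_(z in setT) complex.Im (h z)).

Hypothesis cptX : compact [set: X].

Lemma cts_integrable (h : X -> R) : continuous h ->
  m.-integrable setT (EFin \o (h : borelType X -> R)).
Proof.
move=> hc; apply: measurable_bounded_integrable => //.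
- by rewrite (le_lt_trans (probability_le1 m _))// ltry.
- apply: (measurability _ (measurable_realfun.RGenOpens.measurableE R)) => _ [_ [a [b ->]] <-].
  rewrite setTI; apply: sub_sigma_algebra.
  by apply: open_comp => //; exact: interval_open.
- have : compact (h @` setT) by apply: continuous_compact => //; exact: continuous_subspaceT.
  move=> /compact_bounded; rewrite /bounded_set/bounded_near; apply: filterS => M hM x _ /=.
  by apply: hM; exists x.
Qed.

Lemma param_integral_cts (T : topologicalType) (F : T * X -> R) :
  continuous F -> continuous (fun t => (\int[m]_(z in setT) F (t, z))%R).
Proof.
move=> Fc t0; apply/cvgrPdist_le => e e0.
have sec t : continuous (fun z => F (t, z)).
  move=> z; apply: (@continuous_comp _ _ _ (fun z => (t, z)) F); last exact: Fc.
  by apply: cvg_pair; [exact: cvg_cst | exact: cvg_id].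
have H : \forall t \near t0, [set: X] `<=` [set z | `|F (t0, z) - F (t, z)| <= e].
  move/compact_near_coveringP: cptX; apply => z _.
  have e2 : 0 < e / 2 by rewrite divr_gt0.
  have h1 : \forall z' \near z & t \near t0, `|F (t0, z) - F (t, z')| < e / 2.
    have := @cvgr_dist_lt _ _ _ _ _ F _ (Fc (t0, z)) _ e2.
    case=> -[A B]/= [nA nB] AB; exists (B, A) => //= -[z' t] [/= Bz At].
    exact: (AB (t, z')).
  have h2 : \forall z' \near z & t \near t0, `|F (t0, z) - F (t0, z')| < e / 2.
    have := @cvgr_dist_lt _ _ _ _ _ _ _ (sec t0 z) _ e2.
    move=> nA; exists ([set z' | `|F (t0, z) - F (t0, z')| < e / 2], setT) => /=.
      by split; [exact: nA | exact: (@filterT _ (nbhs t0) _)].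
    by move=> [z' t] [].
  apply: filterS2 h1 h2 => -[z' t]/= a b.
  rewrite -(subrKA (F (t0, z))) (splitr e); apply: (le_trans (ler_normD _ _)).
  by apply: lerD; apply: ltW => //; rewrite distrC.
have mT : measurable [set: borelType X] by exact: measurableT.
apply: filterS H => t Ht.
rewrite -RintegralB//; [|exact: cts_integrable..].
have dc : continuous (fun z => F (t0, z) - F (t, z)).
  by move=> z; apply: cvgB; exact: sec.
apply: le_trans; first by apply: le_normr_Rintegral => //; exact: (cts_integrable dc).
apply: (@le_trans _ _ (\int[m]_(z in setT) e)); last first.
  rewrite Rintegral_cst// -[leRHS]mulr1 le_eqVlt; apply/orP; left; apply/eqP.
  by congr (_ * _); apply: (congr1 fine (y := 1%E)); exact: probability_setT.
apply: le_Rintegral => //.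
- apply: (@cts_integrable (fun z => `|F (t0, z) - F (t, z)|)) => z.
  by apply: cvg_norm; exact: dc.
- exact: (@cts_integrable (fun=> e) (@cst_continuous _ _ _)).
Qed.

Lemma convolution_cts (f g : cfun R (X * X)%type) :
  continuous (fun p : X * X => cintegral (fun z => f (p.1, z) * g (z, p.2)) : R[i]^o).
Proof.
have c : continuous (fun q : (X * X) * X => f (q.1.1, q.2) * g (q.2, q.1.2) : R[i]^o).
  move=> [[x y] z]; apply: cvgM.
  - apply: (@continuous_comp _ _ _ (fun q : (X * X) * X => (q.1.1, q.2)) f); last exact: cts_fun.
    apply: cvg_pair; last exact: cvg_snd.
    by apply: (cvg_comp fst fst); exact: cvg_fst.
  - apply: (@continuous_comp _ _ _ (fun q : (X * X) * X => (q.2, q.1.2)) g); last exact: cts_fun.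
    apply: cvg_pair; first exact: cvg_snd.
    by apply: (cvg_comp fst snd); [exact: cvg_fst|exact: cvg_snd].
apply: Complex_cts.
- apply: (@param_integral_cts _ (fun q => complex.Re (f (q.1.1, q.2) * g (q.2, q.1.2)))).
  by move=> q; apply: (continuous_comp (c q)); exact: Re_cts.
- apply: (@param_integral_cts _ (fun q => complex.Im (f (q.1.1, q.2) * g (q.2, q.1.2)))).
  by move=> q; apply: (continuous_comp (c q)); exact: Im_cts.
Qed.

End ComplexIntegral.

Section Algebra.
Context {R : realType} {X : ptopologicalType}.

Lemma row_cts (f : cfun R (X * X)%type) (x : X) : continuous (fun y => f (x, y)).
Proof.
move=> y; apply: (@continuous_comp _ _ _ (fun y => (x, y)) f); last exact: cts_fun.
by apply: cvg_pair; [exact: cvg_cst | exact: cvg_id].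
Qed.

Lemma col_cts (f : cfun R (X * X)%type) (y : X) : continuous (fun x => f (x, y)).
Proof.
move=> x; apply: (@continuous_comp _ _ _ (fun x => (x, y)) f); last exact: cts_fun.
by apply: cvg_pair; [exact: cvg_id | exact: cvg_cst].
Qed.

Definition row_of (f : cfun R (X * X)%type) x : cfun R X := mkcts (@row_cts f x).
Definition col_of (f : cfun R (X * X)%type) y : cfun R X := mkcts (@col_cts f y).

Variable m : probability (borelType X) R.
Hypothesis cptX : compact [set: X].

Definition star (f g : cfun R (X * X)%type) : cfun R (X * X)%type :=
  mkcts (@convolution_cts R X m cptX f g).

(* The algebra has no unit in general, so closure under scalars is not implied
   by closure under [star]. *)
Definition right_ideal (J : set (cfun R (X * X)%type)) : Prop :=
  GRing.submod_closed (mem J) /\ (forall f g, J f -> J (star f g)).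

Definition left_ideal (J : set (cfun R (X * X)%type)) : Prop :=
  GRing.submod_closed (mem J) /\ (forall f g, J f -> J (star g f)).

Definition calR (V : set (cfun R X)) : set (cfun R (X * X)%type) :=
  [set f | forall y, V (col_of f y)].

Definition calL (V : set (cfun R X)) : set (cfun R (X * X)%type) :=
  [set f | forall x, V (row_of f x)].

Lemma starE f g x y :
  star f g (x, y) = cintegral m (fun z => f (x, z) * g (z, y)).
Proof. by []. Qed.

(* Uniform convergence on each set [X * {y}], respectively [{x} * X]; see
   [cct_cvgP] and [rct_cvgP] below. *)
Definition cct : topologicalType :=
  initial_topology (fun f : cfun R (X * X)%type =>
    (f : {family range (fun y : X => [set: X] `*` [set y]),
          (X * X)%type -> (R[i])^o})).
Definition rct : topologicalType :=
  initial_topology (fun f : cfun R (X * X)%type =>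
    (f : {family range (fun x : X => [set x] `*` [set: X]),
          (X * X)%type -> (R[i])^o})).

Definition cc_closed (A : set (cfun R (X * X)%type)) := closed (A : set cct).
Definition rc_closed (A : set (cfun R (X * X)%type)) := closed (A : set rct).

End Algebra.

Lemma initial_cvgP (S : choiceType) (T : topologicalType) (h : S -> T)
    (F : set_system S) (s : S) : Filter F ->
  F --> (s : initial_topology h) <-> h @ F --> h s.
Proof.
move=> FF; split=> [Fs|hFs].
  exact: (cvg_comp _ _ Fs (@initial_continuous _ _ h s)).
move=> A; rewrite /= (@nbhsE (initial_topology h)) => -[B [[C oC <-] Cs] BA].
by apply: filterS BA _; apply: hFs; exact: open_nbhs_nbhs.
Qed.

Lemma uniform_cvgP (R : realType) (T : choiceType) (A : set T)
    (F : set_system (T -> R[i]^o)) (f : T -> R[i]^o) : Filter F ->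
  {uniform A, F --> f} <-> forall e : R, 0 < e ->
    \forall g \near F, forall x, A x -> `|f x - g x| < e%:C%C.
Proof.
move=> FF; split=> [Ff e e0|H P].
  apply: Ff; apply/uniform_nbhs; exists [set p | ball p.1 e%:C%C p.2]; split.
    by rewrite -entourage_ballE; exists e%:C%C => //=; rewrite ltcR.
  by move=> g /= fg x Ax; have := fg x Ax; rewrite -ball_normE.
move=> /uniform_nbhs[E []]; rewrite -entourage_ballE => -[e /= e0 eE] EP.
have eE' : e = (complex.Re e)%:C%C by rewrite RRe_real// gtr0_real.
have /H : 0 < complex.Re e by rewrite -ltcR -eE'.
rewrite -eE'; apply: filterS => g fg; apply: EP => x Ax; apply: eE => /=.
by rewrite -ball_normE; exact: fg.
Qed.

Section Convergence.
Context {R : realType} {T : topologicalType} {X : ptopologicalType}.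

Lemma norm_top_cvgP (F : set_system (cfun R T)) (f : cfun R T) : Filter F ->
  F --> (f : norm_top) <-> forall e : R, 0 < e ->
    \forall g \near F, forall x, `|f x - (g : cfun R T) x| < e%:C%C.
Proof.
move=> FF; rewrite initial_cvgP.
split=> [/uniform_cvgP H e e0|H].
  by apply: (@filterS _ F _ _ _ _ (H e e0)) => g fg x; exact: fg.
apply/uniform_cvgP => e e0.
by apply: (@filterS _ F _ _ _ _ (H e e0)) => g fg x _; exact: fg.
Qed.

Lemma pct_cvgP (F : set_system (cfun R T)) (f : cfun R T) : Filter F ->
  F --> (f : pct) <-> forall x, (fun g : cfun R T => g x) @ F --> f x.
Proof. by move=> FF; rewrite initial_cvgP pointwise_cvgP. Qed.

Lemma cct_cvgP (F : set_system (cfun R (X * X)%type)) f : Filter F ->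
  F --> (f : cct) <-> forall (y : X) (e : R), 0 < e ->
    \forall g \near F, forall x : X, `|f (x, y) - (g : cfun R (X * X)%type) (x, y)| < e%:C%C.
Proof.
move=> FF; rewrite initial_cvgP fam_cvgP; split=> [H y e e0|H _ [y _ <-]].
  have /uniform_cvgP/(_ _ e0) He := H _ (imageP _ (I : setT y)).
  by apply: (@filterS _ F _ _ _ _ He) => g fg x; exact: fg.
apply/uniform_cvgP => e e0; apply: (@filterS _ F _ _ _ _ (H y e e0)) => g fg [x _] [_ /= ->].
exact: fg.
Qed.

Lemma rct_cvgP (F : set_system (cfun R (X * X)%type)) f : Filter F ->
  F --> (f : rct) <-> forall (x : X) (e : R), 0 < e ->
    \forall g \near F, forall y : X, `|f (x, y) - (g : cfun R (X * X)%type) (x, y)| < e%:C%C.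
Proof.
move=> FF; rewrite initial_cvgP fam_cvgP; split=> [H x e e0|H _ [x _ <-]].
  have /uniform_cvgP/(_ _ e0) He := H _ (imageP _ (I : setT x)).
  by apply: (@filterS _ F _ _ _ _ He) => g fg y; exact: fg.
apply/uniform_cvgP => e e0; apply: (@filterS _ F _ _ _ _ (H x e e0)) => g fg [_ y] [/= -> _].
exact: fg.
Qed.

End Convergence.

(* Main.v *)
Require Import Defs.
From mathcomp Require Import all_boot all_order all_algebra.
From mathcomp Require Import all_classical all_reals all_analysis.
From mathcomp Require Import complex finmap.

(** The closedness assertions hold because every column map [f |-> f(., y)] is
    continuous from the cct to the norm topology and from the pct to the pct,
    and [calR V] is the intersection of the preimages of [V] under these maps.
    For the ideal property, the columns of [star f g] are the functions
    [x |-> \int f(x, z) k(z) dm(z)] with [k = g(., y)].  Taking a partition of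
    unity [(w_p)] subordinate to a finite cover on whose members [f(x, .)]
    oscillates little uniformly in [x], they are uniform limits of the sums
    [\sum_p (\int w_p k dm) f(., p)], which are in [V]. *)

Set Implicit Arguments.
Unset Strict Implicit.
Unset Printing Implicit Defensive.

Import Order.TTheory GRing.Theory Num.Theory.
Import numFieldTopology.Exports numFieldNormedType.Exports.

Local Open Scope classical_set_scope.
Local Open Scope ring_scope.

(** * Membership in a norm-closed set by uniform approximation *)

Section NormClosed.
Context {R : realType} {T : topologicalType}.

(** The sets of functions uniformly [e]-close to [h] generate a filter converging to [h] in
    [norm_top]. Hence every neighbourhood of [h] contains one of these sets, and so meets [V]. *)
Lemma norm_closed_approx (V : set (cfun R T)) (h : cfun R T) :
  norm_closed V ->
  (forall e : R, 0 < e -> exists2 v, V v & forall x, `|h x - v x| < e%:C%C) ->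
  V h.
Proof.
move=> clV happ; apply: clV => B nB.
pose D := [set e : R | 0 < e].
pose ball_ (e : R) := [set g : cfun R T | forall x, `|h x - g x| < e%:C%C].
have FF : Filter (filter_from D ball_).
  apply: filter_from_filter; first by exists 1; rewrite /D/=.
  move=> a b a0 b0; exists (Num.min a b); first by rewrite /D/= lt_min a0.
  by move=> g gab; split=> x; apply: lt_le_trans (gab x) _;
    rewrite lecR ge_min lexx ?orbT.
have /norm_top_cvgP Fh : forall e : R, 0 < e ->
    \forall g \near filter_from D ball_, forall x, `|h x - (g : cfun R T) x| < e%:C%C.
  by move=> e e0; exists e.
have [e e0 eB] := Fh B nB.
by have [v Vv hv] := happ e e0; exists v; split => //; exact: eB.
Qed.

End NormClosed.

(** * Linearity and a norm bound for the complex integral *)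

Section ComplexIntegral.
Context {R : realType} {X : ptopologicalType}.
Variable m : probability (borelType X) R.
Hypothesis cptX : compact [set: X].
Implicit Types h k : X -> R[i]^o.

Let Re_integrable h : continuous h ->
  m.-integrable setT (EFin \o ((fun z => complex.Re (h z)) : borelType X -> R)).
Proof.
by move=> hc; apply: cts_integrable => // z; apply: (continuous_comp (hc z)); exact: Re_cts.
Qed.

Let Im_integrable h : continuous h ->
  m.-integrable setT (EFin \o ((fun z => complex.Im (h z)) : borelType X -> R)).
Proof.
by move=> hc; apply: cts_integrable => // z; apply: (continuous_comp (hc z)); exact: Im_cts.
Qed.

Lemma cintegralD h k : continuous h -> continuous k ->
  cintegral m (fun z => h z + k z) = cintegral m h + cintegral m k.
Proof.
move=> hc kc; rewrite /cintegral.
have mT : measurable [set: borelType X] by exact: measurableT.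
under eq_Rintegral do rewrite raddfD.
under [X in Complex _ X]eq_Rintegral do rewrite raddfD.
rewrite RintegralD ?RintegralD//; first [exact: Re_integrable|exact: Im_integrable].
Qed.

Lemma cintegralZ (a : R[i]) h : continuous h ->
  cintegral m (fun z => a * h z) = a * cintegral m h.
Proof.
move=> hc; rewrite /cintegral.
have mT : measurable [set: borelType X] by exact: measurableT.
case: a => a b.
have E1 z : complex.Re (Complex a b * h z) = a * complex.Re (h z) - b * complex.Im (h z).
  by case: (h z).
have E2 z : complex.Im (Complex a b * h z) = a * complex.Im (h z) + b * complex.Re (h z).
  by case: (h z).
have Ri := Re_integrable hc; have Ii := Im_integrable hc.
have Z c (u : X -> R) : m.-integrable setT (EFin \o (u : borelType X -> R)) ->
    m.-integrable setT (EFin \o ((fun z => c * u z) : borelType X -> R)).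
  by move=> ui; exact: (integrableZl (mu := m) mT c ui).
under eq_Rintegral do rewrite E1.
under [X in Complex _ X]eq_Rintegral do rewrite E2.
rewrite RintegralB ?RintegralD ?RintegralZl//; exact: Z.
Qed.

(** Continuity of the sum is carried through the same induction, because [cintegralD] requires it of
    the tail. *)
Lemma cintegral_sum (I : Type) (s : seq I) (a : I -> R[i]) (h : I -> X -> R[i]^o) :
  (forall i, continuous (h i)) ->
  continuous (fun z => \sum_(i <- s) a i * h i z : R[i]^o) /\
  cintegral m (fun z => \sum_(i <- s) a i * h i z) =
  \sum_(i <- s) a i * cintegral m (h i).
Proof.
move=> hc; elim: s => [|i s [IHc IH]].
  split; first by under eq_fun do rewrite big_nil; exact: cst_continuous.
  rewrite big_nil /cintegral; under eq_Rintegral do rewrite big_nil.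
  under [X in Complex _ X]eq_Rintegral do rewrite big_nil.
  by rewrite /= !Rintegral_cst// ?mul0r.
have ac : continuous (fun z => a i * h i z : R[i]^o).
  by move=> z; apply: cvgM; [exact: cvg_cst|exact: hc].
have -> : (fun z => \sum_(j <- i :: s) a j * h j z) =
    (fun z => a i * h i z + \sum_(j <- s) a j * h j z).
  by apply/funext => z; rewrite big_cons.
split; first by move=> z; apply: cvgD; [exact: ac|exact: IHc].
rewrite big_cons; apply: etrans (cintegralD ac IHc) _.
by congr (_ + _); [exact: (cintegralZ (a i) (hc i))|exact: IH].
Qed.

(** The integrals of the real and imaginary parts are each bounded by [e]. The bound [e + e] is
    crude, but a constant factor is harmless for the approximation below. *)
Lemma norm_cintegral_le h (e : R) : continuous h ->
  (forall z, `|h z| <= e%:C%C) -> `|cintegral m h| <= (e + e)%:C%C.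
Proof.
move=> hc he.
have mT : measurable [set: borelType X] by exact: measurableT.
have bnd (u : X -> R) : continuous u -> (forall z, `|u z| <= e) ->
    `|\int[m]_(z in setT) u z| <= e.
  move=> uc ue.
  apply: le_trans; first by apply: le_normr_Rintegral => //; exact: cts_integrable.
  apply: (@le_trans _ _ (\int[m]_(z in setT) e)); last first.
    rewrite Rintegral_cst// -[leRHS]mulr1 le_eqVlt; apply/orP; left; apply/eqP.
    by congr (_ * _); apply: (congr1 fine (y := 1%E)); exact: probability_setT.
  apply: le_Rintegral => //.
  - apply: (@cts_integrable _ _ _ cptX (fun z => `|u z|)) => z.
    by apply: cvg_norm; exact: uc.
  - exact: (@cts_integrable _ _ _ cptX (fun=> e) (@cst_continuous _ _ _)).
rewrite /cintegral; set a := Rintegral _ _ _; set b := Rintegral _ _ _.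
have -> : Complex a b = a%:C%C + 'i%C * b%:C%C by simpc.
apply: (le_trans (ler_normD _ _)).
rewrite normrM.
have -> : `|'i%C : R[i]| = 1 by rewrite normc_def/= expr0n/= expr1n add0r sqrtr1.
rewrite mul1r !normc_def/= !expr0n/= !addr0 !sqrtr_sqr -rmorphD lecR.
apply: lerD; apply: bnd.
- by move=> z; apply: (continuous_comp (hc z)); exact: Re_cts.
- by move=> z; rewrite -lecR; exact: le_trans (normc_ge_Re _) (he z).
- by move=> z; apply: (continuous_comp (hc z)); exact: Im_cts.
- move=> z; rewrite -lecR; apply: le_trans (he z).
  rewrite normc_def lecR -sqrtr_sqr ler_wsqrtr//=.
  by rewrite lerDr sqr_ge0.
Qed.

End ComplexIntegral.

(* The slices are uniform in the first variable by compactness (tube lemma). *)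
Lemma compact_slice_near (R : realType) (T X : ptopologicalType)
    (F : T * X -> R[i]^o) (z : X) (e : R) :
  compact [set: T] -> continuous F -> 0 < e ->
  \forall z' \near z, forall x, `|F (x, z) - F (x, z')| < e%:C%C.
Proof.
move=> cptT Fc e0.
have e2 : 0 < (e / 2)%:C%C :> R[i] by rewrite ltcR divr_gt0.
suff H : \forall z' \near z,
    [set: T] `<=` [set x | `|F (x, z) - F (x, z')| < e%:C%C].
  by apply: filterS H => z' Hz' x; exact: Hz'.
move/compact_near_coveringP: cptT; apply => x _.
have := @cvgr_dist_lt _ _ _ _ _ F _ (Fc (x, z)) _ e2.
case=> -[A B]/= [nA nB] AB; exists (A, B) => //= -[x' z'] [/= Ax Bz].
have h1 := AB (x', z') (conj Ax Bz).
have h2 := AB (x', z) (conj Ax (nbhs_singleton nB)).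
rewrite -(subrKA (F (x, z))) (splitr e) rmorphD; apply: (le_lt_trans (ler_normD _ _)).
by apply: ltrD => //; rewrite distrC.
Qed.

(** * Partitions of unity on a compact metrizable space *)

Lemma metric_continuous (R : realType) (T : topologicalType) (d : T -> T -> R) (p : T) :
  (forall x y, d x y = d y x) ->
  (forall x y z, d x z <= d x y + d y z) ->
  (forall (x : T) (A : set T),
     nbhs x A <-> exists2 e : R, 0 < e & [set y | d x y < e] `<=` A) ->
  continuous (d p).
Proof.
move=> dC dD dN x; apply/cvgrPdist_lt => e e0.
apply/dN; exists e => // y /= xy; rewrite ltr_norml; apply/andP; split.
  by rewrite ltrBrDl ltrBlDr; apply: le_lt_trans (dD p x y) _; rewrite ltrD2l.
by rewrite ltrBlDl; apply: le_lt_trans (dD p y x) _; rewrite ltrD2l dC.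
Qed.

(** The truncated distances [max(0, r p - d(p, .))] are positive exactly on balls contained in the
    [U p]. Finitely many such balls cover the space, so the sum of their functions is positive
    everywhere and can be divided out. *)
Lemma partition_of_unity (R : realType) (X : ptopologicalType) (U : X -> set X) :
  compact [set: X] -> metrizable R X -> (forall p, nbhs p (U p)) ->
  exists (s : seq X) (w : X -> X -> R),
    [/\ forall p, continuous (w p),
        forall p z, 0 <= w p z,
        forall p z, w p z != 0 -> U p z &
        forall z, \sum_(p <- s) w p z = 1].
Proof.
move=> cptX [d [d0 dC dD dN]] nU.
have /choice[r rP] p : exists r : R, 0 < r /\ [set y | d p y < r] `<=` U p.
  by have /dN[r] := nU p; exists r.
have dc p : continuous (d p) by exact: metric_continuous.
pose u p z := Num.max 0 (r p - d p z).
have uc p : continuous (u p).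
  move=> z; apply: (@continuous_max _ _ (fun=> 0) (fun z => r p - d p z)).
    exact: cvg_cst.
  by apply: cvgB; [exact: cvg_cst|exact: dc].
have u0 p z : 0 <= u p z by rewrite le_max lexx.
have uU p z : 0 < u p z -> d p z < r p.
  by rewrite lt_max ltxx/= subr_gt0.
have oB p : open [set z | 0 < u p z].
  by apply: (@open_comp _ _ (u p) [set t | 0 < t]) => [z _|]; [exact: uc|exact: open_gt].
have := cptX; rewrite compact_cover => /(_ X setT (fun p => [set z | 0 < u p z])).
case=> // [z _|D _ Dcov].
  exists z => //=; rewrite lt_max subr_gt0 (d0 z z).2//; by rewrite (rP z).1 orbT.
pose S z := \sum_(p <- enum_fset D) u p z.
have Sc : continuous S.
  rewrite /S; elim: (enum_fset D) => [|p s IH].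
    by under eq_fun do rewrite big_nil; exact: cst_continuous.
  under eq_fun do rewrite big_cons.
  by move=> z; apply: cvgD; [exact: uc|exact: IH].
have S0 z : 0 < S z.
  have [p /= pD upz] := Dcov z I.
  by rewrite /S (big_rem p)//= ltr_pwDl// sumr_ge0.
exists (enum_fset D), (fun p z => u p z / S z); split.
- move=> p z; apply: cvgM; first exact: uc.
  by apply: cvgV; [rewrite gt_eqF|exact: Sc].
- by move=> p z; rewrite divr_ge0// ltW.
- move=> p z; rewrite mulf_eq0 negb_or => /andP[upz _].
  by apply: (rP p).2; apply: uU; rewrite lt0r upz u0.
- by move=> z; rewrite -mulr_suml -/(S z) divff// gt_eqF.
Qed.

(** * Weighted averages of a continuous family in [V] stay in [V] *)

Section AverageInSubspace.
Context {R : realType} {X : ptopologicalType}.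
Variable m : probability (borelType X) R.
Hypotheses (cptX : compact [set: X]) (metX : metrizable R X).

(** Common form of both ideal properties: the [F z] are the columns (or rows) of the factor in the
    ideal, and [k] is a column (or row) of the other factor. *)
Lemma average_in_subspace (V : set (cfun R X)) (F : X -> cfun R X)
    (k h : cfun R X) :
  GRing.submod_closed (mem V) -> norm_closed V ->
  continuous (fun q : X * X => F q.2 q.1 : R[i]^o) ->
  (forall z, V (F z)) ->
  (forall x, h x = cintegral m (fun z => F z x * k z)) ->
  V h.
Proof.
move=> [V0 VZD] clV Fc VF hE; apply: (norm_closed_approx clV) => e e0.
have [M M0 kM] : exists2 M : R, 0 < M & forall z, `|k z| <= M%:C%C.
  (* The norm takes values in [R[i]]; its real part is used to obtain a real bound from
     compactness. *)
  have nE z : `|k z| = (complex.Re `|k z|)%:C%C by rewrite RRe_real// normr_real.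
  have nc : continuous (fun z => complex.Re `|k z| : R).
    move=> z; apply: (@continuous_comp _ _ _ (fun z => `|k z| : R[i]^o) (fun c => complex.Re c)).
      by apply: cvg_norm; exact: cts_fun.
    exact: Re_cts.
  have : compact ((fun z => complex.Re `|k z|) @` setT).
    by apply: continuous_compact => //; exact: continuous_subspaceT.
  move=> /compact_bounded; rewrite /bounded_set/bounded_near => -[N [Nr NP]].
  (* [NP] accepts only numbers strictly above [N], whence [N + 1]; the [1] makes [M] positive. *)
  exists (Num.max 1 (N + 1)); first by rewrite lt_max ltr01.
  move=> z; rewrite nE lecR; apply: le_trans (ler_norm _) _.
  by apply: (NP _ _ (complex.Re `|k z|)); [rewrite lt_max ltrDl ltr01 orbT|exists z].
(* Oscillation at most [e'] and [|k| <= M] bound the integrand of the error by [e / 3];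
   [norm_cintegral_le] doubles this, leaving [2e / 3 < e]. *)
pose e' := e / 3 / M.
have e'0 : 0 < e' by rewrite !divr_gt0.
have [s [w [wc w0 wU w1]]] := partition_of_unity cptX metX
  (fun p => compact_slice_near p cptX Fc e'0).
have Fxc x : continuous (fun z => F z x).
  move=> z; apply: (@continuous_comp _ _ _ (fun z => (x, z)) (fun q => F q.2 q.1)).
    by apply: cvg_pair; [exact: cvg_cst | exact: cvg_id].
  exact: Fc.
have wkc p : continuous (fun z => (w p z)%:C%C * k z : R[i]^o).
  move=> z; apply: cvgM; last exact: cts_fun.
  by apply: Complex_cts; [exact: wc|exact: cst_continuous].
pose c p := cintegral m (fun z => (w p z)%:C%C * k z).
exists (\sum_(p <- s) c p *: F p).
  have VD t : \sum_(p <- t) c p *: F p \in mem V.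
    elim: t => [|p t IH]; first by rewrite big_nil.
    by rewrite big_cons; apply: VZD => //; rewrite in_setE; exact: VF.
  by have := VD s; rewrite in_setE.
move=> x.
have sumE t : (\sum_(p <- t) c p *: F p : cfun R X) x = \sum_(p <- t) F p x * c p.
  elim: t => [|p t IH]; first by rewrite !big_nil.
  by rewrite !big_cons -IH mulrC.
have [sc sE] := cintegral_sum m cptX s (fun p => F p x) wkc.
have Fkc : continuous (fun z => F z x * k z : R[i]^o).
  by move=> z; apply: cvgM; [exact: Fxc|exact: cts_fun].
(* The difference is written as a sum with a factor [-1], so that [cintegralD] and [cintegralZ]
   merge it into one integral. *)
have sc' : continuous (fun z => (-1) * \sum_(p <- s) F p x * ((w p z)%:C%C * k z) : R[i]^o).
  by move=> z; apply: cvgM; [exact: cvg_cst|exact: sc].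
rewrite sumE -sE hE -mulN1r -(cintegralZ m cptX (-1) sc) -(cintegralD m cptX Fkc sc').
have e3 : e / 3 + e / 3 < e.
  by rewrite -mulrDr gtr_pMr// -mulr2n -(mulr_natl _ 2) ltr_pdivrMr// mul1r ltr_nat.
apply: (@le_lt_trans _ _ (e / 3 + e / 3)%:C%C); last by rewrite ltcR.
have hc : continuous (fun z => F z x * k z +
    -1 * \sum_(p <- s) F p x * ((w p z)%:C%C * k z) : R[i]^o).
  by move=> z; apply: cvgD; [exact: Fkc|exact: sc'].
apply: (norm_cintegral_le m cptX hc) => z.
(* As the weights sum to 1, [F z x] is the weighted sum of copies of itself and can be compared with
   the [F p x] term by term. *)
have -> : F z x * k z + -1 * (\sum_(p <- s) F p x * ((w p z)%:C%C * k z)) =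
    (\sum_(p <- s) (w p z)%:C%C * (F z x - F p x)) * k z.
  under [in RHS]eq_bigr do rewrite mulrBr.
  rewrite sumrB -mulr_suml -rmorph_sum w1 mul1r mulrBl mulN1r; congr (_ - _).
  by rewrite mulr_suml; apply: eq_bigr => p _; rewrite mulrA (mulrC (F p x)).
rewrite normrM.
have -> : (e / 3)%:C%C = e'%:C%C * M%:C%C by rewrite -rmorphM /e' divfK// gt_eqF.
apply: ler_pM => //.
apply: le_trans (ler_norm_sum _ _ _) _.
have -> : e'%:C%C = \sum_(p <- s) (w p z)%:C%C * e'%:C%C.
  by rewrite -mulr_suml -rmorph_sum w1 mul1r.
apply: ler_sum => p _; rewrite normrM ger0_norm ?lecR//.
(* A nonzero weight places [z] in the neighbourhood of [p] given by [compact_slice_near], where the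
   oscillation bound holds for all [x] at once. *)
have [->|wpz] := eqVneq (w p z) 0; first by rewrite !mul0r.
apply: ler_wpM2l; first by rewrite lecR.
by rewrite distrC; apply: ltW; exact: wU.
Qed.

End AverageInSubspace.

(** * Closedness in the cct, rct and pct *)

Section Closedness.
Context {R : realType} {X : ptopologicalType}.
Implicit Types V : set (cfun R X).

Lemma calRE V : calR V = \bigcap_(y in setT) ((fun f => col_of f y) @^-1` V).
Proof. by apply/seteqP; split=> f fV y; [move=> _|]; exact: fV. Qed.

Lemma calLE V : calL V = \bigcap_(x in setT) ((fun f => row_of f x) @^-1` V).
Proof. by apply/seteqP; split=> f fV x; [move=> _|]; exact: fV. Qed.

(** The condition of [cct_cvgP] at a fixed [y] is precisely norm convergence of the columns at
    [y]. *)
Lemma cc_closed_calR V : norm_closed V -> cc_closed (calR V).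
Proof.
move=> clV; rewrite /cc_closed calRE; apply: closed_bigI => y _.
apply: (@preimage_closed (@cct R X) (@norm_top R X) (fun f => col_of f y)) clV => f _.
have FF : Filter (nbhs (f : @cct R X)) by exact: nbhs_filter.
apply/(norm_top_cvgP _ (fmap_filter _ FF)) => e e0.
have /(cct_cvgP _ FF) H : nbhs (f : @cct R X) --> (f : @cct R X) by exact: cvg_id.
exact: H.
Qed.

Lemma rc_closed_calL V : norm_closed V -> rc_closed (calL V).
Proof.
move=> clV; rewrite /rc_closed calLE; apply: closed_bigI => x _.
apply: (@preimage_closed (@rct R X) (@norm_top R X) (fun f => row_of f x)) clV => f _.
have FF : Filter (nbhs (f : @rct R X)) by exact: nbhs_filter.
apply/(norm_top_cvgP _ (fmap_filter _ FF)) => e e0.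
have /(rct_cvgP _ FF) H : nbhs (f : @rct R X) --> (f : @rct R X) by exact: cvg_id.
exact: H.
Qed.

(** The value at [x] of the column at [y] is the value of [f] at [(x, y)], so pointwise convergence
    passes to columns. *)
Lemma pc_closed_calR V : pc_closed V -> pc_closed (calR V).
Proof.
move=> clV; rewrite /pc_closed calRE; apply: closed_bigI => y _.
apply: (@preimage_closed (@pct R (X * X)%type) (@pct R X) (fun f => col_of f y)) clV => f _.
have FF : Filter (nbhs (f : @pct R (X * X)%type)) by exact: nbhs_filter.
apply/(pct_cvgP _ (fmap_filter _ FF)) => x.
have /(pct_cvgP _ FF) H : nbhs (f : @pct R (X * X)%type) --> (f : @pct R (X * X)%type).
  exact: cvg_id.
exact: H.
Qed.

Lemma pc_closed_calL V : pc_closed V -> pc_closed (calL V).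
Proof.
move=> clV; rewrite /pc_closed calLE; apply: closed_bigI => x _.
apply: (@preimage_closed (@pct R (X * X)%type) (@pct R X) (fun f => row_of f x)) clV => f _.
have FF : Filter (nbhs (f : @pct R (X * X)%type)) by exact: nbhs_filter.
apply/(pct_cvgP _ (fmap_filter _ FF)) => y.
have /(pct_cvgP _ FF) H : nbhs (f : @pct R (X * X)%type) --> (f : @pct R (X * X)%type).
  exact: cvg_id.
exact: H.
Qed.

End Closedness.

(** * The ideal properties *)

Section Ideals.
Context {R : realType} {X : ptopologicalType}.
Variable m : probability (borelType X) R.
Hypotheses (cptX : compact [set: X]) (metX : metrizable R X).
Variable V : set (cfun R X).
Hypotheses (linV : GRing.submod_closed (mem V)) (clV : norm_closed V).

Lemma right_ideal_calR : right_ideal m cptX (calR V).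
Proof.
have [V0 VZD] := linV; split.
  (* Taking columns commutes with the linear operations only up to extensional equality of bundled
     functions, which [continuousEP] supplies. *)
  split; first by rewrite in_setE => y; move: V0; rewrite in_setE; congr V; exact/continuousEP.
  move=> a f g; rewrite !in_setE => Vf Vg y.
  have := VZD a (col_of f y) (col_of g y).
  rewrite !in_setE => /(_ (Vf y) (Vg y)); congr V; exact/continuousEP.
move=> f g Vf y.
apply: (@average_in_subspace _ _ m cptX metX V (col_of f) (col_of g y)) => //.
move=> q; apply: (@continuous_comp _ _ _ (fun q : X * X => (q.1, q.2)) f).
  by apply: cvg_pair; [exact: cvg_fst|exact: cvg_snd].
exact: cts_fun.
Qed.

Lemma left_ideal_calL : left_ideal m cptX (calL V).
Proof.
have [V0 VZD] := linV; split.
  split; first by rewrite in_setE => x; move: V0; rewrite in_setE; congr V; exact/continuousEP.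
  move=> a f g; rewrite !in_setE => Vf Vg x.
  have := VZD a (row_of f x) (row_of g x).
  rewrite !in_setE => /(_ (Vf x) (Vg x)); congr V; exact/continuousEP.
move=> f g Vf x.
apply: (@average_in_subspace _ _ m cptX metX V (row_of f) (row_of g x)) => //.
  move=> q; apply: (@continuous_comp _ _ _ (fun q : X * X => (q.2, q.1)) f).
    by apply: cvg_pair; [exact: cvg_snd|exact: cvg_fst].
  exact: cts_fun.
(* Here the factor in the ideal stands on the right; commutativity in [R[i]] brings the integrand
   into the form [F z y * k z]. *)
move=> y; rewrite -[LHS]/(cintegral m (fun z => g (x, z) * f (z, y))).
by congr cintegral; apply/funext => z; exact: mulrC.
Qed.

End Ideals.

Theorem theorem5p1 (R : realType) (X : ptopologicalType)
    (cptX : compact [set: X]) (metX : metrizable R X)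
    (m : probability (borelType X) R) (suppm : msupport m = [set: X])
    (V : set (cfun R X))
    (linV : GRing.submod_closed (mem V)) (clV : norm_closed V) :
  [/\ cc_closed (calR V) /\ right_ideal m cptX (calR V),
      rc_closed (calL V) /\ left_ideal m cptX (calL V) &
      pc_closed V -> pc_closed (calR V) /\ pc_closed (calL V)].
Proof.
split.
- by split; [exact: cc_closed_calR|exact: right_ideal_calR].
- by split; [exact: rc_closed_calL|exact: left_ideal_calL].
- by move=> pcV; split; [exact: pc_closed_calR|exact: pc_closed_calL].
Qed.
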